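(* The $\mathcal{SDD}$ size of $\mathrm{HWB}_n$ is $O(n^3)$.
   Context: $\mathrm{HWB}_n(x_1,\ldots,x_n)$ (hidden weighted bit) is the boolean function such that an assignment $f:\{x_1,\dots,x_n\}\to\{0,1\}$ is a model iff, letting $i=f(x_1)+\cdots+f(x_n)$, we have $i\ge 1$ and $f(x_i)=1$. Circuits are NNFs: boolean circuits (DAGs with a single output gate) whose input gates are labelled by constants $\bot,\top$ or literals on variables, and whose internal gates are unbounded-fanin $\vee$- and $\wedge$-gates; a circuit need not read all variables of the vtree it respects. The size of a circuit is the number of arcs of its DAG. $C_g$ denotes the subcircuit with output gate $g$. For a class $\mathcal{L}$ and boolean function $f$, the $\mathcal{L}$ size of $f$ is the minimum size of a circuit in $\mathcal{L}$ computing $f$. A vtree for a finite nonempty variable set $Y$ is a rooted, full, ordered binary tree whose leaves are identified bijectively with $Y$; for an internal node $v$, $v_l,v_r$ are its children, $T_v$ the subtree rooted at $v$, $Y_v$ its leaf set. An SDD respecting a vtree $T$ is defined inductively: (i) a single gate labelled by a literal on a variable that is a leaf of $T$; (ii) a single gate labelled by a constant (any $T$); (iii) $C=\bigvee_{i=1}^m (C_{p_i}\wedge C_{s_i})$ with $m\ge 2$ (output $\vee$-gate with wires from $m$ $\wedge$-gates, the $i$-th with wires from gates $p_i,s_i$) such that for some internal node $v$ of $T$ and all $i$: $C_{p_i}$ is an SDD respecting a subtree of $T_{v_l}$, $C_{s_i}$ is an SDD respecting a subtree of $T_{v_r}$, and as functions on $Y_{v_l}$: $C_{p_i}\not\equiv\bot$,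 $C_{p_i}\wedge C_{p_j}\equiv\bot$ for $i<j$, $\bigvee_i C_{p_i}\equiv\top$. $\mathcal{SDD}$ is the class of all circuits that are SDDs respecting some vtree. *)

(* Defs.v *)
From mathcomp Require Import all_boot.

Set Implicit Arguments.
Unset Strict Implicit.
Unset Printing Implicit Defensive.

Definition assignment (V : finType) := {ffun V -> bool}.
Definition boolfun (V : finType) := assignment V -> bool.

Inductive label (V : Type) :=
  | Const of bool
  | Lit of V & bool  (* [Lit x true] is x, [Lit x false] is its negation *)
  | Or
  | And.
Arguments Const {V}.
Arguments Or {V}.
Arguments And {V}.

Definition is_input V (l : label V) : bool :=
  match l with Const _ | Lit _ _ => true | Or | And => false end.

(* [wire g h] is an arc from g into h. Arcs form a relation rather than a
   multiset: in an SDD no gate needs two parallel arcs, since a prime and its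
   sub have disjoint variables and the prime is never constant. *)
Record circuit (V : Type) := Circuit {
  gate : finType;
  lab : gate -> label V;
  wire : rel gate;
  out : gate;
  wire_acyclic : forall g h, wire g h -> ~~ connect wire h g;
  input_gateP : forall g, is_input (lab g) = [forall h, ~~ wire h g];
  out_uniqueP : forall g, (g == out) = [forall h, ~~ wire g h]
}.
Arguments lab {V c} g.
Arguments wire {V c} g h.
Arguments out {V} c.

Definition csize V (C : circuit V) : nat :=
  #|[set e : gate C * gate C | wire e.1 e.2]|.

(* Evaluation by recursion on a depth bound k; [evalE] below shows that k = #|gate C|
   is always enough. *)
Fixpoint eval_rec (V : finType) (C : circuit V) (f : assignment V) (k : nat)
    (g : gate C) : bool :=
  if k is k'.+1 then
    match lab g with
    | Const b => b
    | Lit x b => f x == b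
    | Or => [exists h, wire h g && eval_rec f k' h]
    | And => [forall h, wire h g ==> eval_rec f k' h]
    end
  else false.

(* The value at f of the subcircuit with output gate g. *)
Definition eval (V : finType) (C : circuit V) (f : assignment V) (g : gate C) :=
  eval_rec f #|gate C| g.

Lemma eval_rec_stable (V : finType) (C : circuit V) (f : assignment V) k (g : gate C) :
  #|[set h | connect wire h g]| <= k -> eval_rec f k g = eval_rec f k.+1 g.
Proof.
elim: k g => [|k IHk] g.
  by rewrite leqn0 cards_eq0 => /eqP/setP/(_ g); rewrite !inE connect0.
move=> le_g.
have IH h : wire h g -> eval_rec f k h = eval_rec f k.+1 h.
  move=> hg; apply: IHk; rewrite -ltnS; apply: leq_trans le_g.
  apply: proper_card; apply/properP; split.
    apply/subsetP=> z; rewrite !inE => zh.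
    exact: connect_trans zh (connect1 hg).
  by exists g; rewrite !inE ?connect0 // wire_acyclic.
rewrite /= -/(eval_rec f k.+1).
case: (lab g) => //.
- by apply: eq_existsb => h; case: (boolP (wire h g)) => // /IH ->.
- by apply: eq_forallb => h; case: (boolP (wire h g)) => // /IH ->.
Qed.

Lemma evalE (V : finType) (C : circuit V) (f : assignment V) (g : gate C) :
  eval f g =
    match lab g with
    | Const b => b
    | Lit x b => f x == b
    | Or => [exists h, wire h g && eval f h]
    | And => [forall h, wire h g ==> eval f h]
    end.
Proof. by rewrite {1}/eval eval_rec_stable ?max_card. Qed.

Definition computes (V : finType) (C : circuit V) (F : boolfun V) : Prop :=
  forall f, eval f (out C) = F f.

Inductive vtree (V : Type) :=
  | Leaf of V
  | Node of vtree V & vtree V.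

Fixpoint leaves V (T : vtree V) : seq V :=
  match T with
  | Leaf x => [:: x]
  | Node l r => leaves l ++ leaves r
  end.

(* T is a vtree for the set of variables occurring in [leaves T]. *)
Definition wf_vtree (V : eqType) (T : vtree V) : bool := uniq (leaves T).

(* [subtree u T]: u = T_v for some node v of T. *)
Fixpoint subtree V (u T : vtree V) : Prop :=
  u = T \/ match T with
           | Leaf _ => False
           | Node l r => subtree u l \/ subtree u r
           end.

(* [sdd_at T g]: the subcircuit C_g is an SDD respecting T. In [SddOr], the
   internal node v has T_v = Node vl vr, the i-th and-gate is [a i], and its
   two inputs are [p i] and [s i]. The conditions on the C_(p i) as functions
   on Y_(vl) are stated with assignments to all of V, which is the same since
   C_(p i) only reads variables in Y_(vl). *)
Inductive sdd_at (V : finType) (C : circuit V) : vtree V -> gate C -> Prop :=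
  | SddLit T g x b of lab g = Lit x b & x \in leaves T : sdd_at T g
  | SddConst T g b of lab g = Const b : sdd_at T g
  | SddOr T g vl vr m (a p s : 'I_m -> gate C) (Tp Ts : 'I_m -> vtree V) of
      2 <= m
    & subtree (Node vl vr) T
    & lab g = Or
    & injective a
    & (forall h, wire h g <-> exists i, h = a i)
    & (forall i, lab (a i) = And)
    & (forall i h, wire h (a i) <-> h = p i \/ h = s i)
    & (forall i, subtree (Tp i) vl)
    & (forall i, sdd_at (Tp i) (p i))
    & (forall i, subtree (Ts i) vr)
    & (forall i, sdd_at (Ts i) (s i))
    & (forall i, exists f, eval f (p i))
    & (forall i j : 'I_m, i < j -> forall f, ~~ (eval f (p i) && eval f (p j)))
    & (forall f, exists i, eval f (p i)) :
      sdd_at T g.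

Definition SDD (V : finType) (C : circuit V) : Prop :=
  exists2 T : vtree V, wf_vtree T & sdd_at T (out C).

(* s is the L size of F: the minimum size of a circuit in L computing F. *)
Definition is_class_size (V : finType) (L : circuit V -> Prop) (F : boolfun V)
    (s : nat) : Prop :=
  (exists C, [/\ L C, computes C F & csize C = s]) /\
  (forall C, L C -> computes C F -> s <= csize C).

(* The variable x_(k+1) is represented by the ordinal k : 'I_n. *)
Definition HWB (n : nat) : boolfun 'I_n := fun f =>
  let i := \sum_(k < n) f k in
  (1 <= i) && [exists k : 'I_n, (k.+1 == i) && f k].

(* Main.v *)
(** Split the variables as {x_1, ..., x_(n-1)} | {x_n}. If i is the weight of
    x_1 ... x_(n-1), then HWB_n is x_i when x_n = 0 and x_(i+1) when x_n = 1, so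
    the triple (i, x_i, x_(i+1)) determines HWB_n as a function of x_n. The root
    decision therefore has at most 4n primes "weight = i, x_i = a, x_(i+1) = b",
    one for each satisfiable triple (i, a, b) with a and b fixed bits. With the
    triple fixed, such a prime is recognized by a layered automaton that counts
    ones and checks two positions; unfolded along a right-linear vtree, it is an
    SDD of size O(n^2). *)

Require Import Defs.
From HB Require Import structures.
From mathcomp Require Import all_boot zify.
From Stdlib Require Import Classical.

Set Implicit Arguments.
Unset Strict Implicit.
Unset Printing Implicit Defensive.

(** * Minimum circuit size *)

(** Descent on size: either a smaller circuit of the class computes [F], or [C] is already minimal.
    The class is an arbitrary predicate, so excluded middle decides which. *)
Lemma is_class_size_le (V : finType) (L : circuit V -> Prop) (F : boolfun V)
    (C : circuit V) :
  L C -> computes C F -> exists s, is_class_size L F s /\ s <= csize C.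
Proof.
have [k] := ubnP (csize C); elim: k C => // k IHk C ltCk LC FC.
have [[D [LD FD ltDC]]|noD] :=
  classic (exists D, [/\ L D, computes D F & csize D < csize C]).
  have [s [Fs le_s]] := IHk D (leq_trans ltDC ltCk) LD FD.
  by exists s; split=> //; apply: leq_trans le_s (ltnW ltDC).
exists (csize C); split=> //; split; first by exists C.
by move=> D LD FD; rewrite leqNgt; apply/negP=> ltDC; case: noD; exists D.
Qed.

Lemma subtree_refl V (T : vtree V) : subtree T T.
Proof. by case: T => *; left. Qed.

(** * Circuits from ranked predecessor lists *)

(* [out_uniqueP] forces every gate to reach the output, so the circuit given by
   the predecessor lists [pr] is cut down to the gates that reach [r]. *)
Section Prune.

Variables (V G : finType) (lb : G -> label V) (pr : G -> seq G) (rk : G -> nat).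
Variable r : G.
Hypothesis rk_pr : forall g h, h \in pr g -> rk h < rk g.
Hypothesis pr_input : forall g, is_input (lb g) = nilp (pr g).

Let pwire : rel G := fun h g => h \in pr g.
Let live := {g : G | connect pwire g r}.
Let live_wire : rel live := fun h g => val h \in pr (val g).

Let live_acyclic g h : live_wire g h -> ~~ connect live_wire h g.
Proof.
move=> gh; apply/negP=> /connectP[s].
(* Ranks do not drop along a path, while the arc from [g] to [h] raises them strictly, so no path
   leads back. *)
suff: path live_wire h s -> rk (val h) <= rk (val (last h s)).
  by move=> le_s /le_s + eq_g; rewrite -eq_g leqNgt rk_pr.
elim: s {gh} h => //= z s IHs h /andP[hz /IHs].
exact/leq_trans/ltnW/rk_pr.
Qed.

Let live_pred (g : live) h : h \in pr (val g) -> connect pwire h r.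
Proof. by move=> gh; apply: connect_trans (connect1 gh) (valP g). Qed.

Let mk h (hr : connect pwire h r) : live := exist _ h hr.

Let live_input g : is_input (lb (val g)) = [forall h, ~~ live_wire h g].
Proof.
rewrite pr_input /live_wire; apply/nilP/forallP => [-> //|no_pr].
case Epr: (pr (val g)) => [//|h s].
have gh: h \in pr (val g) by rewrite Epr mem_head.
by have := no_pr (mk (live_pred gh)); rewrite gh.
Qed.

Let live_out : live := mk (connect0 pwire r).

Let live_out_unique g : (g == live_out) = [forall h, ~~ live_wire g h].
Proof.
apply/eqP/forallP => [-> h | no_succ].
  apply/negP=> rh; have := valP h; case/connectP=> s.
  have lt_rh : rk r < rk (val h) by apply: rk_pr.
  suff: forall x, path pwire x s -> rk x <= rk (last x s).
    by move=> le_s /le_s + eq_r; rewrite -eq_r leqNgt lt_rh.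
  elim: s {h rh lt_rh} => //= z s IHs x /andP[xz /IHs].
  exact/leq_trans/ltnW/rk_pr.
apply: val_inj => /=; case/connectP: (valP g) => [[|h s]] //=.
case/andP=> gh hs Er; have hr: connect pwire h r by apply/connectP; exists s.
by have /negP[] := no_succ (mk hr).
Qed.

Definition prune : circuit V :=
  @Circuit V live (fun g => lb (val g)) live_wire live_out
    live_acyclic live_input live_out_unique.

Lemma csize_prune : csize prune <= \sum_g size (pr g).
Proof.
(* The swap puts the head of an arc first, to match the sum over gates and their predecessors. *)
pose emb (e : live * live) := (val e.2, val e.1).
have emb_inj : injective emb.
  by move=> [g h] [g' h'] [/val_inj-> /val_inj->].
rewrite /csize -(card_imset _ emb_inj).
apply: (@leq_trans (\sum_g \sum_(h in pr g) 1)).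
  rewrite pair_big_dep sum1_card; apply/subset_leq_card/subsetP.
  by move=> _ /imsetP[[g h] + ->]; rewrite !inE.
by apply: leq_sum => g _; rewrite sum1_card; apply: card_size.
Qed.

Section Semantics.

Variable sem : assignment V -> G -> bool.
Hypothesis sem_lb : forall f g, sem f g =
  match lb g with
  | Const b => b
  | Lit x b => f x == b
  | Or => has (sem f) (pr g)
  | And => all (sem f) (pr g)
  end.

(** The local gate equations determine values by induction on rank, and predecessors of a live gate
    are live, so pruning removes no input of a remaining gate. *)
Lemma eval_prune f (g : gate prune) : eval f g = sem f (val g).
Proof.
have [k] := ubnP (rk (val g)); elim: k g => // k IHk g lt_gk.
have IH h : live_wire h g -> eval (C := prune) f h = sem f (val h).
  by move=> gh; apply/IHk/(leq_trans (rk_pr gh)).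
rewrite evalE sem_lb /=; case: (lb _) => //.
  apply/existsP/hasP => [[h /andP[gh]] | [h gh fh]].
    by rewrite IH // => fh; exists (val h).
  exists (mk (live_pred gh)).
  have gh' : live_wire (mk (live_pred gh)) g by [].
  by rewrite gh' IH.
apply/forallP/allP => [fpr h gh | fpr h].
  have gh' : live_wire (mk (live_pred gh)) g by [].
  by have := fpr (mk (live_pred gh)); rewrite /= gh' IH.
by apply/implyP=> gh; rewrite IH // fpr.
Qed.

(** Vacuous when [g0] is pruned away, so it can be proved for all gates without checking which of
    them reach [r]. *)
Definition sdd_over T g0 := forall g : gate prune, val g = g0 -> sdd_at T g.

(** Decisions are naturally indexed by keys, here bits or classes; positions in the list [ks]
    provide the ordinals that [SddOr] asks for. *)
Lemma sdd_over_or (I : eqType) (ks : seq I) (a p s : I -> G) T g vl vr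
    (Tp Ts : I -> vtree V) :
    uniq ks -> 1 < size ks -> subtree (Node vl vr) T -> lb g = Or ->
    injective a -> pr g = map a ks ->
    (forall k, k \in ks -> lb (a k) = And) ->
    (forall k, k \in ks -> pr (a k) = [:: p k; s k]) ->
    (forall k, subtree (Tp k) vl) -> (forall k, sdd_over (Tp k) (p k)) ->
    (forall k, subtree (Ts k) vr) -> (forall k, sdd_over (Ts k) (s k)) ->
    (forall k, k \in ks -> exists f, sem f (p k)) ->
    (forall f k l, k \in ks -> l \in ks -> sem f (p k) -> sem f (p l) -> k = l) ->
    (forall f, has (fun k => sem f (p k)) ks) ->
  sdd_over T g.
Proof.
move=> Uks gt1 vT gOr inj_a prg aAnd pra pT psdd sT ssdd psat pdisj pcov g' Eg'.
pose key := tnth (in_tuple ks).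
have keyP i : key i \in ks by apply: mem_tnth.
have key_inj : injective key by apply/tuple_uniqP.
have gaP i : a (key i) \in pr (val g') by rewrite Eg' prg map_f.
pose ga i : live := mk (live_pred (gaP i)).
have va i : val (ga i) = a (key i) by [].
have gpP i : p (key i) \in pr (val (ga i)) by rewrite va pra // mem_head.
have gsP i : s (key i) \in pr (val (ga i)) by rewrite va pra // !inE eqxx orbT.
pose gp i : live := mk (live_pred (gpP i)).
pose gs i : live := mk (live_pred (gsP i)).
have vp i : val (gp i) = p (key i) by [].
have vs i : val (gs i) = s (key i) by [].
apply: (@SddOr V prune T g' vl vr (size ks) ga gp gs (Tp \o key) (Ts \o key)) => //.
- by rewrite /lab /= Eg'.
- by move=> i j /(congr1 val); rewrite !va => /inj_a/key_inj.
- move=> h; split=> [|[i ->]]; last exact: gaP.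
  rewrite /wire /= /live_wire Eg' prg => /mapP[k /(nthP k)[i lti Ek] Eh].
  exists (Ordinal lti); apply: val_inj.
  by rewrite [LHS]Eh -Ek /= /key (tnth_nth k).
- by move=> i; apply: aAnd (keyP i).
- move=> i h.
  have -> : wire h (ga i) = (val h \in [:: p (key i); s (key i)]).
    by rewrite -(pra _ (keyP i)).
  rewrite !inE; split.
    by case/orP=> /eqP Eh; [left | right]; apply: val_inj; rewrite Eh.
  by case=> ->; rewrite eqxx ?orbT.
- by move=> i; apply: pT.
- by move=> i; exact: (psdd (key i) (gp i) (vp i)).
- by move=> i; apply: sT.
- by move=> i; exact: (ssdd (key i) (gs i) (vs i)).
- by move=> i; have [f fp] := psat _ (keyP i); exists f; rewrite eval_prune vp.
- move=> i j ltij f; apply/negP; rewrite !eval_prune !vp => /andP[fi fj].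
  have Eij := key_inj _ _ (pdisj _ _ _ (keyP i) (keyP j) fi fj).
  by rewrite Eij ltnn in ltij.
move=> f; have /hasP[k /(nthP k)[i lti Ek] fk] := pcov f.
by exists (Ordinal lti); rewrite eval_prune vp /key (tnth_nth k) /= Ek.
Qed.

End Semantics.

End Prune.

(** * Gates of the automaton circuit *)

(* [Branch k] conjoins the k-th prime with its sub, a [RootSub u v] testing the
   last variable (u and v are the values at 0 and 1). [State k q] accepts from
   state q before reading variable k, and [Step k q b] does so when variable k
   has value b. *)
Inductive auto_gate (p : nat) (K Q : finType) :=
  | Root
  | Branch of K
  | RootSub of bool & bool
  | State of 'I_p.+1 & Q
  | Step of 'I_p.+1 & Q & bool
  | Var of 'I_p.+1 & bool.
Arguments Root {p K Q}.
Arguments Branch {p K Q}.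
Arguments RootSub {p K Q}.
Arguments State {p K Q}.
Arguments Step {p K Q}.
Arguments Var {p K Q}.

Section AutoGateFinite.

Variables (p : nat) (K Q : finType).

Let code : Type := unit + K + (bool * bool) +
  ('I_p.+1 * Q) + ('I_p.+1 * Q * bool) + ('I_p.+1 * bool).

Definition auto_encode (g : auto_gate p K Q) : code :=
  match g with
  | Root => inl (inl (inl (inl (inl tt))))
  | Branch k => inl (inl (inl (inl (inr k))))
  | RootSub u v => inl (inl (inl (inr (u, v))))
  | State k q => inl (inl (inr (k, q)))
  | Step k q b => inl (inr (k, q, b))
  | Var k b => inr (k, b)
  end.

Definition auto_decode (c : code) : auto_gate p K Q :=
  match c with
  | inl (inl (inl (inl (inl _)))) => Root
  | inl (inl (inl (inl (inr k)))) => Branch k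
  | inl (inl (inl (inr (u, v)))) => RootSub u v
  | inl (inl (inr (k, q))) => State k q
  | inl (inr (k, q, b)) => Step k q b
  | inr (k, b) => Var k b
  end.

Lemma auto_encodeK : cancel auto_encode auto_decode.
Proof. by case. Qed.

HB.instance Definition _ := Finite.copy (auto_gate p K Q) (can_type auto_encodeK).

(** The factor 3 counts one [State] and two [Step] gates per position and state, the factor 2 the
    [Var] gates, and 5 the root with four [RootSub] gates. *)
Lemma card_auto_gate :
  #|{: auto_gate p K Q}| <= #|K| + 3 * (p.+1 * #|Q|) + 2 * p.+1 + 5.
Proof.
have := leq_card _ (can_inj auto_encodeK).
rewrite !card_sum !card_prod !card_bool card_unit card_ord => /leq_trans; apply.
by move: #|K| (p.+1 * #|Q|) => a b; clear; lia.
Qed.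

End AutoGateFinite.

(** * SDDs from layered automata *)

Section Automaton.

Variables (p : nat) (K Q : finType).
Variables (delta : nat -> Q -> bool -> Q) (acc : Q -> bool) (start : K -> Q).
Variables (cls : assignment 'I_p.+2 -> K) (sub : K -> bool -> bool).

Definition run (f : assignment 'I_p.+2) (k d : nat) (q : Q) :=
  foldl (fun q j => delta j q (f (inord j))) q (iota k d).
Arguments run : simpl never.

Lemma runS f k d q : run f k d.+1 q = run f k.+1 d (delta k q (f (inord k))).
Proof. by []. Qed.

(** Each assignment has exactly one class, so the automata started in the states [start k] are
    disjoint and exhaustive, as primes must be. *)
Hypothesis run_start : forall f k,
  acc (run f 0 p.+1 (start k)) = (cls f == k).
Hypothesis two_classes : exists f f', cls f != cls f'.

(** A boolean function of one variable is a constant or a literal; if its values differ, the value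
    [v] at 1 is the sign of the literal. *)
Definition leaf_label (x : 'I_p.+2) (u v : bool) : label 'I_p.+2 :=
  if u == v then Const u else Lit x v.

(** Only inhabited classes are kept, because a prime must be satisfiable. *)
Definition branches := [seq k <- enum K | [exists f, cls f == k]].

(* Capped at p because [inord p.+1] would wrap around to 0 and create a cycle
   through the gates [Step p q b], which the root does not reach. *)
Definition next (k : 'I_p.+1) : 'I_p.+1 := inord (minn k.+1 p).

Definition auto_lab (g : auto_gate p K Q) : label 'I_p.+2 :=
  match g with
  | Root => Or
  | Branch _ => And
  | RootSub u v => leaf_label ord_max u v
  | State k q =>
      if k == p :> nat
      then leaf_label (inord k) (acc (delta k q false)) (acc (delta k q true))
      else Or
  | Step _ _ _ => And
  | Var k b => Lit (inord k) b
  end.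

Definition auto_pr (g : auto_gate p K Q) : seq (auto_gate p K Q) :=
  match g with
  | Root => [seq Branch k | k <- branches]
  | Branch k => [:: State ord0 (start k); RootSub (sub k false) (sub k true)]
  | State k q =>
      if k == p :> nat then [::] else [seq Step k q b | b <- [:: false; true]]
  | Step k q b => [:: Var k b; State (next k) (delta k q b)]
  | RootSub _ _ | Var _ _ => [::]
  end.

(** Each variable costs two ranks, one for [State] and one for [Step]. At position p truncated
    subtraction gives [Step] rank 1, still above the [State] of rank 0 to which [next] is capped. *)
Definition auto_rank (g : auto_gate p K Q) : nat :=
  match g with
  | Root => (2 * p).+2
  | Branch _ => (2 * p).+1
  | State k _ => 2 * (p - k)
  | Step k _ _ => (2 * (p - k) - 2).+1
  | RootSub _ _ | Var _ _ => 0
  end.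

Lemma nextE (k : 'I_p.+1) : next k = minn k.+1 p :> nat.
Proof. by rewrite inordK // ltnS geq_minr. Qed.

Lemma auto_rank_pr g h : h \in auto_pr g -> auto_rank h < auto_rank g.
Proof.
case: g => [|k|u v|k q|k q b|k b] //=.
- by case/mapP=> k _ ->.
- by rewrite !inE => /orP[] /eqP-> //=; rewrite subn0.
- have [// | neq_kp] := eqVneq; have := ltn_ord k.
  by rewrite !inE => ? /orP[] /eqP-> /=; lia.
by rewrite !inE => /orP[] /eqP-> //=; rewrite nextE; lia.
Qed.

Lemma leaf_label_input x u v : is_input (leaf_label x u v).
Proof. by rewrite /leaf_label; case: eqP. Qed.

Lemma mem_branches f : cls f \in branches.
Proof. by rewrite mem_filter mem_enum andbT; apply/existsP; exists f. Qed.

Lemma auto_pr_input g : is_input (auto_lab g) = nilp (auto_pr g).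
Proof.
case: g => [|k|u v|k q|k q b|k b] //=; rewrite ?leaf_label_input //.
  have [f _] := two_classes; have := mem_branches f.
  by rewrite /nilp size_map; case: branches.
by case: eqP => _ /=; rewrite ?leaf_label_input.
Qed.

Definition auto_sem (f : assignment 'I_p.+2) (g : auto_gate p K Q) : bool :=
  let from (k : 'I_p.+1) q := acc (run f k (p.+1 - k) q) in
  match g with
  | Root => sub (cls f) (f ord_max)
  | Branch k => (cls f == k) && sub k (f ord_max)
  | RootSub u v => if f ord_max then v else u
  | State k q => from k q
  | Step k q b => (f (inord k) == b) && from (next k) (delta k q b)
  | Var k b => f (inord k) == b
  end.

Lemma leaf_labelE f x u v :
  (if f x then v else u) =
    match leaf_label x u v with
    | Const b => b
    | Lit y b => f y == b
    | Or | And => false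
    end.
Proof. by case: u v => [] [] /=; case: (f x). Qed.

Lemma auto_sem_lab f g :
  auto_sem f g =
    match auto_lab g with
    | Const b => b
    | Lit x b => f x == b
    | Or => has (auto_sem f) (auto_pr g)
    | And => all (auto_sem f) (auto_pr g)
    end.
Proof.
case: g => [|k|u v|k q|k q b|k b] //=.
- rewrite has_map; apply/idP/hasP => [fk | [k _ /= /andP[/eqP->]]//].
  by exists (cls f); rewrite ?mem_branches //= eqxx.
- rewrite andbT ?subn0 run_start.
  by case: eqP => //= _; case: (f ord_max).
- by rewrite leaf_labelE /leaf_label; case: eqP.
- have lt_k := ltn_ord k; have [eq_kp | neq_kp] := eqVneq.
    have -> : p.+1 - k = 1 by lia.
    rewrite /run /=.
    have := leaf_labelE f (inord k) (acc (delta k q false)) (acc (delta k q true)).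
    by rewrite /leaf_label; case: eqP => _ <-; case: (f _).
  have lt_kp : k < p by lia.
  rewrite /= nextE (minn_idPl lt_kp) subSn // runS orbF subSS /=.
  by case: (f (inord k)); rewrite ?orbF.
by rewrite andbT.
Qed.

Definition auto_circuit := prune Root auto_rank_pr auto_pr_input.

Fixpoint comb (d : nat) : vtree 'I_p.+2 :=
  if d is d'.+1 then Node (Leaf (inord (p - d))) (comb d') else Leaf (inord p).

Definition auto_vtree := Node (comb p) (Leaf ord_max).

Lemma leaves_comb d : d <= p -> leaves (comb d) = map inord (iota (p - d) d.+1).
Proof.
elim: d => [_|d IHd ltdp] /=; first by rewrite subn0.
by rewrite IHd ?(ltnW ltdp) //= subnSK.
Qed.

Lemma wf_auto_vtree : wf_vtree auto_vtree.
Proof.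
rewrite /wf_vtree /= leaves_comb // subnn cats1 rcons_uniq; apply/andP; split.
  apply/mapP=> [[k]]; rewrite mem_iota /= => lt_kp /(congr1 val) /=.
  by rewrite inordK; lia.
rewrite map_inj_in_uniq ?iota_uniq // => k l.
rewrite !mem_iota /= => lt_kp lt_lp /(congr1 val) /=.
by rewrite !inordK; lia.
Qed.

Let over := sdd_over Root auto_rank_pr auto_pr_input.

Lemma sdd_over_leaf T g x u v :
  auto_lab g = leaf_label x u v -> x \in leaves T -> over T g.
Proof.
rewrite /leaf_label => + xT g' Eg'; case: eqP => _ Elab.
  by apply: (@SddConst _ _ _ _ u); rewrite /lab /= Eg'.
by apply: (@SddLit _ _ _ _ x v); rewrite // /lab /= Eg'.
Qed.

(** Shannon expansion on variable k: the primes are its two literals and the subs are the successor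
    states, over a comb that is one variable shorter. *)
Lemma sdd_over_state d (k : 'I_p.+1) q : p - k = d -> over (comb d) (State k q).
Proof.
elim: d k q => [|d IHd] k q kd; have lt_k := ltn_ord k.
  have Ekp : k = p :> nat by lia.
  apply: (sdd_over_leaf (x := inord k)); first by rewrite /= Ekp eqxx.
  by rewrite /= inE Ekp.
have neq_kp : k != p :> nat by lia.
apply: (sdd_over_or auto_sem_lab (ks := [:: false; true]) (a := Step k q)
  (p := Var k) (s := fun b => State (next k) (delta k q b))
  (Tp := fun=> Leaf (inord (p - d.+1))) (Ts := fun=> comb d)
  isT isT (subtree_refl (comb d.+1))) => //=.
- by rewrite (negPf neq_kp).
- by move=> b b' [].
- by rewrite (negPf neq_kp).
- by left.
- move=> b g Eg; apply: (@SddLit _ _ _ _ (inord k) b); rewrite /lab /= ?Eg //.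
  by rewrite inE -kd; apply/eqP; congr inord; lia.
- by move=> _; apply: subtree_refl.
- by move=> b; apply: IHd; rewrite nextE; lia.
- by move=> b _; exists [ffun=> b]; rewrite ffunE.
- by move=> f b b' _ _ /eqP-> /eqP.
by move=> f; case: (f _).
Qed.

Lemma two_branches : 1 < size branches.
Proof.
have [f [f' neq_f]] := two_classes.
have := mem_branches f'; have := mem_branches f.
case: branches => [|k [|l s]] //; rewrite !inE => /eqP Ef /eqP Ef'.
by rewrite Ef Ef' eqxx in neq_f.
Qed.

Lemma SDD_auto_circuit : SDD auto_circuit.
Proof.
exists auto_vtree; first exact: wf_auto_vtree.
suff: over auto_vtree Root by apply.
apply: (sdd_over_or auto_sem_lab (ks := branches) (a := Branch)
  (p := fun k => State ord0 (start k))
  (s := fun k => RootSub (sub k false) (sub k true))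
  (Tp := fun=> comb p) (Ts := fun=> Leaf ord_max)
  _ two_branches (subtree_refl auto_vtree)) => //=.
- by rewrite filter_uniq ?enum_uniq.
- by move=> k l [].
- by move=> _; apply: subtree_refl.
- by move=> k; apply: sdd_over_state; rewrite subn0.
- by left.
- by move=> k; apply: (sdd_over_leaf (x := ord_max)); rewrite //= inE.
- move=> k; rewrite mem_filter => /andP[/existsP[f fk] _].
  by exists f; rewrite ?subn0 run_start.
- by move=> f k l _ _; rewrite ?subn0 !run_start => /eqP<- /eqP.
by move=> f; apply/hasP; exists (cls f); rewrite ?mem_branches // ?subn0 run_start.
Qed.

Lemma computes_auto_circuit :
  computes auto_circuit (fun f => sub (cls f) (f ord_max)).
Proof. by move=> f; rewrite (eval_prune auto_sem_lab). Qed.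

(** All gates have fan-in at most two except the root, which has one arc per inhabited class. *)
Lemma csize_auto_circuit :
  csize auto_circuit <= 3 * #|K| + 6 * (p.+1 * #|Q|) + 4 * p.+1 + 10.
Proof.
apply: leq_trans (csize_prune _ _ _) _.
have Epr g : size (auto_pr g) <= 2 + (g == Root) * #|K|.
  case: g => [|k|u v|k q|k q b|k b] //=.
    rewrite size_map size_filter mul1n cardE; apply/leqW/leqW/count_size.
  by case: eqP.
apply: leq_trans (leq_sum _ (fun g _ => Epr g)) _.
rewrite big_split /= sum_nat_const -big_distrl /=.
rewrite (bigD1 Root) //= big1 => [|g /negPf-> //].
apply: (@leq_trans (#|{: auto_gate p K Q}| * 2 + #|K|)); first by rewrite mul1n.
have := card_auto_gate p K Q.
by move: #|K| (p.+1 * #|Q|) #|{: auto_gate p K Q}| => a b c; clear; lia.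
Qed.

End Automaton.

(** * The automaton for the hidden weighted bit *)

Section HiddenWeightedBit.

Variable p : nat.
Implicit Type f : assignment 'I_p.+2.

Definition hwb_key : finType := ('I_p.+2 * bool * bool)%type.
(** A state holds the guessed key, the number of ones read, and whether all tests have passed.
    Carrying the key lets one transition function serve all branches. *)
Definition hwb_state : finType := (hwb_key * 'I_p.+2 * bool)%type.

Definition bit f j := f (inord j).
Definition weight f d := \sum_(j <- iota 0 d) bit f j.

(* [bit f i.-1] is the paper's x_i and [bit f i] its x_(i+1). For weight 0 the
   paper's x_0 is replaced by x_1, which is then 0. For weight p.+1 the last
   component is set to true, because HWB is 1 on the all-ones assignment, and
   [bit f p.+1] is the variable of the sub. *)
Definition hwb_class f : hwb_key :=
  let i := weight f p.+1 in (inord i, bit f i.-1, (i == p.+1) || bit f i).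

(** For i = 0 the truncated predecessor makes both tests fall on position 0. *)
Definition key_ok (key : hwb_key) j (x : bool) :=
  let: (i, a, b) := key in ((j == i.-1) ==> (x == a)) && ((j == i) ==> (x == b)).

Definition hwb_delta j (q : hwb_state) (x : bool) : hwb_state :=
  let: (key, c, ok) := q in (key, inord (c + x), ok && key_ok key j x).

(** For i = p + 1 no position that is read tests b. Acceptance then demands that b be true, as
    [hwb_class] sets it; otherwise two keys would accept the same assignments. *)
Definition hwb_acc (q : hwb_state) :=
  let: ((i, a, b), c, ok) := q in [&& ok, c == i & (i == p.+1 :> nat) ==> b].

Definition hwb_start (key : hwb_key) : hwb_state := (key, ord0, true).

Definition hwb_sub (key : hwb_key) (t : bool) := if t then key.2 else key.1.2.

Lemma weight_le f d : weight f d <= d.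
Proof.
rewrite /weight -[d in _ <= d](size_iota 0) -sum1_size.
by apply: leq_sum => j _; case: bit.
Qed.

Lemma run_hwb f key d : d <= p.+1 ->
  run hwb_delta f 0 d (hwb_start key) =
    (key, inord (weight f d), all (fun j => key_ok key j (bit f j)) (iota 0 d)).
Proof.
elim: d => [_|d IHd lt_dp].
  rewrite /run /weight big_nil /=; congr (_, _, _).
  by apply: val_inj; rewrite /= inordK.
have le_w := weight_le f d; have := IHd (ltnW lt_dp).
have -> : run hwb_delta f 0 d.+1 (hwb_start key) =
    hwb_delta d (run hwb_delta f 0 d (hwb_start key)) (bit f d).
  by rewrite /run -[d.+1]addn1 iotaD foldl_cat.
move=> ->; rewrite /weight -[d.+1]addn1 iotaD.
(* The counter does not wrap: after d reads it is at most d, which is below p + 2. *)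
by rewrite big_cat big_seq1 all_cat /= andbT inordK // ltnS ltnW // (leq_ltn_trans le_w).
Qed.

Lemma hwb_accE f key :
  hwb_acc (run hwb_delta f 0 p.+1 (hwb_start key)) = (hwb_class f == key).
Proof.
rewrite run_hwb //; case: key => [[i a] b]; have le_w := weight_le f p.+1.
rewrite /hwb_class; set w := weight f p.+1 in le_w *.
have wK : (inord w : 'I_p.+2) = w :> nat by rewrite inordK.
apply/idP/eqP => [/and3P[/allP ok /eqP Ei last] | [<- <- <-]].
  have {}ok j : j \in iota 0 p.+1 ->
    ((j == w.-1) ==> (bit f j == a)) && ((j == w) ==> (bit f j == b)).
    by move/ok; rewrite /= -Ei wK.
  congr (_, _, _); first exact: Ei.
    have /ok : w.-1 \in iota 0 p.+1 by rewrite mem_iota; lia.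
    by rewrite eqxx => /andP[/eqP].
  have [Ew | neq_w] := eqVneq w p.+1.
    by move: last; rewrite -Ei wK Ew eqxx.
  have /ok : w \in iota 0 p.+1 by rewrite mem_iota; lia.
  by rewrite eqxx => /andP[_ /eqP].
apply/and3P; split=> //; last by rewrite wK; apply/implyP=> ->.
apply/allP=> j; rewrite mem_iota /= wK => lt_j.
apply/andP; split; apply/implyP=> /eqP Ej; first by rewrite Ej.
by rewrite -Ej (ltn_eqF lt_j).
Qed.

Lemma hwb_two_classes : exists f f', hwb_class f != hwb_class f'.
Proof.
exists [ffun=> false], [ffun=> true].
have w0 : weight [ffun=> false] p.+1 = 0.
  by rewrite /weight big1 // => j _; rewrite /bit ffunE.
have w1 : weight [ffun=> true] p.+1 = p.+1.
  rewrite -[RHS](size_iota 0) -sum1_size /weight.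
  by apply: eq_bigr => j _; rewrite /bit ffunE.
rewrite /hwb_class w0 w1; apply/eqP=> -[/(congr1 val)].
by rewrite /= !inordK.
Qed.

Lemma weight_HWB f : \sum_(k < p.+2) f k = weight f p.+1 + f ord_max.
Proof.
rewrite big_ord_recr /=; congr (_ + _).
rewrite /weight -[iota 0 _]/(index_iota 0 p.+1) big_mkord; apply: eq_bigr => k _.
by congr (nat_of_bool (f _)); apply: val_inj; rewrite /= inordK // ltnW // ltnS.
Qed.

Lemma HWBE f : HWB f = hwb_sub (hwb_class f) (f ord_max).
Proof.
rewrite /HWB weight_HWB /hwb_class /=.
have := weight_le f p.+1; set w := weight f p.+1 => le_w.
have pick_bit i : i < p.+2 -> [exists k : 'I_p.+2, (k == i :> nat) && f k] = bit f i.
  move=> lt_i; apply/existsP/idP => [[k /andP[/eqP Ek fk]] | fi].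
    by rewrite /bit -Ek inord_val.
  by exists (inord i); rewrite inordK // eqxx.
rewrite /hwb_sub /=; case flast: (f ord_max) => /=.
  (* The last variable is 1, so the total weight is w + 1 and selects the ordinal w. If w = p + 1
     this is the last variable itself. *)
  rewrite addn1 /=.
  under eq_existsb do rewrite eqSS.
  rewrite pick_bit //; case: eqP => //= Ew.
  by rewrite /bit -flast; congr (f _); apply: val_inj; rewrite /= inordK // Ew.
(* The last variable is 0. For w = 0 the function is false, and so is the stored bit at position 0,
   since no variable is 1. *)
rewrite addn0; case Ew: w => [|i] /=.
  have : \sum_(j <- iota 0 p.+1) bit f j == 0 by rewrite -/(weight f p.+1) -/w Ew.
  rewrite big_cons addn_eq0 => /andP[+ _].
  by case: bit.
under eq_existsb do rewrite eqSS.
by rewrite pick_bit // ltnW // -Ew.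
Qed.

Lemma SDD_HWB : exists C : circuit 'I_p.+2,
  [/\ SDD C, computes C (@HWB p.+2) & csize C <= 100 * p.+2 ^ 3].
Proof.
exists (auto_circuit hwb_delta hwb_acc hwb_start hwb_sub hwb_two_classes); split.
- exact: SDD_auto_circuit hwb_accE _.
- by move=> f; rewrite HWBE; apply: (computes_auto_circuit _ hwb_accE).
apply: leq_trans (csize_auto_circuit _ _ _ _ _) _.
(* With n = p + 2 there are 4n keys and 8n^2 states, so the bound is at most 48n^3 plus linear
   terms. *)
rewrite !card_prod !card_bool !card_ord; clear; nia.
Qed.

End HiddenWeightedBit.

Theorem theorem3 :
  exists c n0 : nat, forall n : nat, n0 <= n ->
    exists s : nat, is_class_size (@SDD 'I_n) (@HWB n) s /\ s <= c * n ^ 3.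
Proof.
(* Splitting off the last variable must leave at least one other, hence the threshold 2. *)
exists 100, 2 => -[|[|p]] // _; have [C [sddC FC sizeC]] := SDD_HWB p.
have [s [Fs le_s]] := is_class_size_le sddC FC.
by exists s; split=> //; apply: leq_trans sizeC.
Qed.
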